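(* Let $\alpha,\beta,\gamma$ be complex numbers with $\gamma\notin\{0,-1,-2,\ldots\}$, and let $(a_n)_{n=0}^{\infty}$ be a sequence of complex numbers satisfying $$a_{n+1}=\Bigl(\alpha+\frac{\beta}{n+\gamma}\Bigr)a_n\qquad\text{for all } n\ge 0.$$ For integers $n\ge 1$ and $k\ge 0$ let $d_n^{(k)}=\det\bigl(a_{i+j+k-2}\bigr)_{1\le i,j\le n}$. If $a_0=1$, then for all $n\ge 1$ and $k\ge 0$, $$d_n^{(k)}=\prod_{1\le i\le j\le n-1}\frac{i\,\bigl[\alpha(i+\gamma-1)+\beta\bigr]\bigl[\alpha(i-1)-\beta\bigr]}{\bigl[i+\gamma-1\bigr]\bigl[i+j+\gamma-2\bigr]\bigl[i+j+\gamma-1\bigr]}\ \times\ \prod_{j=0}^{k-1}\prod_{i=1}^{n}\frac{\alpha(i+j+\gamma-1)+\beta}{i+j+\gamma+n-2}.$$ Moreover, if $a_0$ is allowed to be arbitrary, then the expression for $d_n^{(k)}$ gets multiplied by $a_0^n$; that is, for all $n\ge 1$ and $k\ge 0$, $$d_n^{(k)}=a_0^n\prod_{1\le i\le j\le n-1}\frac{i\,\bigl[\alpha(i+\gamma-1)+\beta\bigr]\bigl[\alpha(i-1)-\beta\bigr]}{\bigl[i+\gamma-1\bigr]\bigl[i+j+\gamma-2\bigr]\bigl[i+j+\gamma-1\bigr]}\ \times\ \prod_{j=0}^{k-1}\prod_{i=1}^{n}\frac{\alpha(i+j+\gamma-1)+\beta}{i+j+\gamma+n-2}.$$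
   Context: For a sequence $(a_n)_{n=0}^{\infty}$, the (generalized) Hankel transform is the doubly-indexed sequence of determinants $d_n^{(k)}=\det H_n^{(k)}$, $n=1,2,\ldots$, $k=0,1,\ldots$, where $H_n^{(k)}$ is the $n\times n$ Hankel matrix with $(i,j)$ entry $a_{i+j+k-2}$, $1\le i,j\le n$. Empty products are equal to $1$. The product over $1\le i\le j\le n-1$ runs over all pairs of integers $(i,j)$ satisfying these inequalities. *)

(* Defs.v *)
From mathcomp Require Import all_boot all_order all_algebra.
From mathcomp Require Import reals complex.

Set Implicit Arguments.
Unset Strict Implicit.
Unset Printing Implicit Defensive.

Import GRing.Theory Num.Theory.

Local Open Scope ring_scope.

(* The rows and columns of 'M_n are numbered from 0, so the 1-based entry
   a_(i+j+k-2) is a (i + j + k) here. *)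
Definition hankel_mx (C : Type) (a : nat -> C) (n k : nat) : 'M[C]_n :=
  \matrix_(i < n, j < n) a (i + j + k)%N.

Definition hankel_transform (C : comNzRingType) (a : nat -> C) (n k : nat) : C :=
  \det (hankel_mx a n k).

(* Main.v *)
(* Write r_m = alpha + beta / (m + gamma), so that a_(m+1) = r_m a_m.  Subtracting
   r_i times row i from row i+1 clears the first column of the Hankel matrix and
   turns the entry in row i+1 and column j+1 into
     - (j+1) beta / (i + gamma) * b_(i+j),   b_m = a_(m+1) / (m + 1 + gamma),
   where b satisfies the recurrence with (alpha, beta - alpha, gamma + 2).  Hence
   the determinant of size n+1 reduces to one of size n, and the case k = 0
   follows by induction on n.  For k > 0, the shifted sequence a_(m+k) satisfies
   the recurrence with gamma + k in place of gamma.  The product identities that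
   remain telescope, and never need division by a factor of a numerator, which
   might vanish. *)
Require Import Defs.
From mathcomp Require Import all_boot all_order all_algebra.
From mathcomp Require Import reals complex.
From mathcomp Require Import ring.

Set Implicit Arguments.
Unset Strict Implicit.
Unset Printing Implicit Defensive.

Import GRing.Theory Num.Theory.

Local Open Scope ring_scope.
Local Open Scope complex_scope.

Lemma prod_triangle_recr (R : comNzRingType) (T : nat -> nat -> R) (n : nat) :
  \prod_(1 <= i < n.+1) \prod_(i <= j < n.+1) T i j =
  (\prod_(1 <= i < n) \prod_(i <= j < n) T i j) * \prod_(1 <= i < n.+1) T i n.
Proof.
case: n => [|n]; first by rewrite !big_geq ?mulr1.
(* The last row of the larger triangle has a single entry, which is also the last term of the added
   column. *)
rewrite big_nat_recr //= big_nat1 [X in _ = _ * X]big_nat_recr //= mulrA.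
congr (_ * _); rewrite -big_split /= big_nat [RHS]big_nat.
by apply: eq_bigr => i /andP[_ lt_in]; rewrite big_nat_recr // ltnW.
Qed.

(** Each operation uses the original preceding row, so together they are left multiplication by a
    lower bidiagonal matrix [L] with unit diagonal. This keeps the determinant and clears the first
    column below its top entry. *)
Lemma det_eliminate_first_col (F : comNzRingType) (n : nat) (M : 'M[F]_n.+1)
    (c : 'I_n -> F) :
  (forall i, M (lift ord0 i) ord0 = c i * M (widen_ord (leqnSn n) i) ord0) ->
  \det M = M ord0 ord0 *
    \det (\matrix_(i < n, j < n) (M (lift ord0 i) (lift ord0 j)
                        - c i * M (widen_ord (leqnSn n) i) (lift ord0 j))).
Proof.
move=> Mc.
pose L : 'M[F]_n.+1 := \matrix_(i, j)
  (if unlift ord0 i is Some i' then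
     (i == j)%:R - c i' * (widen_ord (leqnSn n) i' == j)%:R
   else (i == j)%:R).
have LM0 j : (L *m M) ord0 j = M ord0 j.
  rewrite mxE (bigD1 ord0) //= big1 => [|k k0]; rewrite !mxE unlift_none ?eqxx.
    by rewrite mul1r addr0.
  by rewrite eq_sym (negPf k0) mul0r.
have LMS i j : (L *m M) (lift ord0 i) j =
    M (lift ord0 i) j - c i * M (widen_ord (leqnSn n) i) j.
  rewrite mxE.
  under eq_bigr => k _ do
    rewrite mxE liftK mulrBl -mulrA !mulr_natl !mulrb eq_sym
            [widen_ord _ _ == _]eq_sym.
  by rewrite sumrB -mulr_sumr -!big_mkcond !big_pred1_eq.
have detL : \det L = 1.
  rewrite det_trig => [|].
    apply: big1 => i _; rewrite mxE; case: unliftP => [i' ->|_]; rewrite eqxx //.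
    by rewrite -val_eqE /= /bump leq0n add1n ltn_eqF // mulr0 subr0.
  apply/is_trig_mxP => i j; rewrite mxE; case: unliftP => [i' ->|->] ltij.
    rewrite -!val_eqE (ltn_eqF ltij) /= ltn_eqF ?mulr0 ?subr0 //.
    by rewrite (leq_trans _ ltij).
  by rewrite -val_eqE ltn_eqF.
have -> : \det M = \det (L *m M) by rewrite det_mulmx detL mul1r.
move: (L *m M) LM0 LMS => N N0 NS.
rewrite (expand_det_col _ ord0) big_ord_recl N0.
rewrite big1 => [|i _]; last by rewrite NS Mc subrr mul0r.
rewrite addr0 /cofactor expr0 mul1r; congr (_ * \det _).
by apply/matrixP => i j; rewrite !mxE NS.
Qed.

(** For [i, j >= 1] every denominator is [gamma] plus a natural number. *)
Definition hankel_factor (F : fieldType) (alpha beta gamma : F) (i j : nat) : F :=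
  i%:R * (alpha * (i%:R + gamma - 1) + beta) * (alpha * (i%:R - 1) - beta)
  / ((i%:R + gamma - 1) * (i%:R + j%:R + gamma - 2%:R)
     * (i%:R + j%:R + gamma - 1)).

Definition hankel_product (F : fieldType) (alpha beta gamma : F) (n : nat) : F :=
  \prod_(1 <= i < n) \prod_(i <= j < n) hankel_factor alpha beta gamma i j.

Definition first_order_rec (F : fieldType) (alpha beta gamma : F) (a : nat -> F) : Prop :=
  forall n, a n.+1 = (alpha + beta / (n%:R + gamma)) * a n.

Lemma hankel_transform_shift (F : comNzRingType) (a : nat -> F) (n k : nat) :
  hankel_transform a n k = hankel_transform (fun m => a (m + k)%N) n 0.
Proof.
by congr (\det _); apply/matrixP => i j; rewrite !mxE addn0.
Qed.

Lemma hankel_transform_rec (F : fieldType) (alpha beta gamma : F) (a : nat -> F) (n : nat) :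
  (forall m, m%:R + gamma != 0) -> first_order_rec alpha beta gamma a ->
  hankel_transform a n.+1 0 =
  a 0 * (\prod_(j < n) (- (j.+1%:R * beta) / (j%:R + gamma)))
      * hankel_transform (fun m => a m.+1 / (m.+1%:R + gamma)) n 0.
Proof.
move=> gamma_neq0 a_rec.
pose r i := alpha + beta / (i%:R + gamma).
rewrite {1}/hankel_transform (@det_eliminate_first_col _ _ _ (fun i => r i)).
  rewrite mxE -mulrA; congr (_ * _).
  (* Since r_(i+j+1) - r_i = - (j+1) beta / ((i + gamma) (i+j+1 + gamma)), each entry splits into a
     row factor [u], a column factor [v] and a Hankel entry. *)
  pose u : 'rV[F]_n := \row_i (i%:R + gamma)^-1.
  pose v : 'rV[F]_n := \row_j (- (j.+1%:R * beta)).
  transitivity (\det (diag_mx u *m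
      hankel_mx (fun m => a m.+1 / (m.+1%:R + gamma)) n 0 *m diag_mx v)).
    congr (\det _); apply/matrixP => i j.
    rewrite mul_mx_diag mxE mul_diag_mx !mxE /= /bump !leq0n !add1n !addn0.
    rewrite !addSn !addnS a_rec /r.
    (* Identifies each denominator met by [field] with some m + gamma, leaving an equation for
       [ring]. *)
    have nz x m : x = m%:R + gamma -> x != 0 by move->.
    by field; rewrite (nz _ (i + j).+1) 1?(nz _ i) //; ring.
  rewrite !det_mulmx !det_diag mulrAC; congr (_ * _).
  by rewrite -big_split /=; apply: eq_bigr => j _; rewrite !mxE mulrC.
by move=> i; rewrite !mxE /= /bump leq0n !add1n !addn0 a_rec.
Qed.

(** The ratio of consecutive terms is (alpha (m+1+gamma) + beta) / (m+2+gamma) = alpha + (beta -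
    alpha) / (m+2+gamma). *)
Lemma first_order_rec_descent (F : fieldType) (alpha beta gamma : F) (a : nat -> F) :
  (forall m, m%:R + gamma != 0) -> first_order_rec alpha beta gamma a ->
  first_order_rec alpha (beta - alpha) (gamma + 2%:R)
    (fun m => a m.+1 / (m.+1%:R + gamma)).
Proof.
move=> gamma_neq0 a_rec m; rewrite a_rec.
have nz x k : x = k%:R + gamma -> x != 0 by move->.
by field; rewrite (nz _ m.+1) 1?(nz _ m.+2) //; ring.
Qed.

(** The two bracketed numerators agree on both sides, as do the denominators containing j. The
    quotient of the factors is (i+1)(i+1+gamma) / (i (i+gamma)), which telescopes. *)
Lemma hankel_factor_row_descent (F : fieldType) (alpha beta gamma : F) (m j : nat) :
  (forall m, m%:R + gamma != 0) ->
  \prod_(1 <= i < m.+1) hankel_factor alpha beta gamma i.+1 j.+1 =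
  m.+1%:R * (m.+1%:R + gamma) / (1 + gamma) *
  \prod_(1 <= i < m.+1) hankel_factor alpha (beta - alpha) (gamma + 2%:R) i j.
Proof.
move=> gamma_neq0.
have nz x k : x = k%:R + gamma -> x != 0 by move->.
elim: m => [|m IH].
  rewrite !big_geq // mulr1 mul1r divff //; exact: (gamma_neq0 1%N).
rewrite big_nat_recr // [in RHS]big_nat_recr //= IH.
rewrite /hankel_factor; field.
by rewrite (nz _ (m + j).+2) 1?(nz _ (m + j).+1) 1?(nz _ m.+2) 1?(nz _ 1%N)
           1?(nz _ m.+1) //; ring.
Qed.

(** Telescoping in i would leave alpha gamma + beta in a denominator; as it may vanish, it is kept
    as a factor on the left. *)
Lemma hankel_factor_row_shift (F : fieldType) (alpha beta gamma : F) (m n : nat) :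
  (forall m, m%:R + gamma != 0) ->
  (alpha * gamma + beta) / gamma *
    \prod_(1 <= i < m.+1) hankel_factor alpha beta (gamma + 1) i n.+1 =
  (\prod_(1 <= i < m.+1) hankel_factor alpha beta gamma i n.+1)
  * ((alpha * (m%:R + gamma) + beta) * (n%:R + gamma) * (n.+1%:R + gamma)
     / ((m%:R + gamma) * (m%:R + n%:R + gamma) * (m%:R + n.+1%:R + gamma))).
Proof.
move=> gamma_neq0.
have nz x k : x = k%:R + gamma -> x != 0 by move->.
elim: m => [|m IH].
  rewrite !big_geq // mulr1 mul1r.
  by field; rewrite (nz _ n.+1) 1?(nz _ n) 1?(nz _ 0%N) //; ring.
rewrite big_nat_recr //= [in RHS]big_nat_recr //= mulrA IH.
rewrite /hankel_factor; field.
by rewrite (nz _ (m + n).+2) 1?(nz _ (m + n).+1) 1?(nz _ m.+1)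
           1?(nz _ (m + n)) 1?(nz _ m) //; ring.
Qed.

Lemma hankel_product_recr (F : fieldType) (alpha beta gamma : F) (n : nat) :
  hankel_product alpha beta gamma n.+1 =
  hankel_product alpha beta gamma n
  * \prod_(1 <= i < n.+1) hankel_factor alpha beta gamma i n.
Proof. exact: prod_triangle_recr. Qed.

(** In each added column, the factor at i = 1 supplies (alpha gamma + beta) (- beta), and the rest
    is a column of the descended triangle up to the telescoped quotient. *)
Lemma hankel_product_descent (F : fieldType) (alpha beta gamma : F) (n : nat) :
  (forall m, m%:R + gamma != 0) ->
  hankel_product alpha beta gamma n.+1 =
  (\prod_(j < n) (- (j.+1%:R * beta) / (j%:R + gamma)))
  * ((alpha * gamma + beta) / (gamma * (1 + gamma))) ^+ n
  * hankel_product alpha (beta - alpha) (gamma + 2%:R) n.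
Proof.
move=> gamma_neq0.
have nz x k : x = k%:R + gamma -> x != 0 by move->.
elim: n => [|n IH]; first by rewrite /hankel_product big_ord0 !big_geq ?mulr1.
rewrite hankel_product_recr IH [in RHS]hankel_product_recr.
rewrite big_ltn // big_add1 /= hankel_factor_row_descent // big_ord_recr /= exprS.
rewrite /hankel_factor; field.
by rewrite (nz _ 1%N) 1?(nz _ 0%N) 1?(nz _ n) 1?(nz _ n.+1) //; ring.
Qed.

Lemma hankel_product_shift (F : fieldType) (alpha beta gamma : F) (n : nat) :
  (forall m, m%:R + gamma != 0) ->
  ((alpha * gamma + beta) / gamma) ^+ n
  * hankel_product alpha beta (gamma + 1) n =
  hankel_product alpha beta gamma n *
  \prod_(1 <= i < n.+1)
     ((alpha * (i%:R + gamma - 1) + beta) / (i%:R + gamma + n%:R - 2%:R)).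
Proof.
move=> gamma_neq0.
have nz x k : x = k%:R + gamma -> x != 0 by move->.
(* The denominators depend on the size of the triangle; raising the size by one moves each to its
   successor, so the quotient telescopes. *)
have denom_shift m n' :
    \prod_(1 <= i < m.+1)
      ((alpha * (i%:R + gamma - 1) + beta) / (i%:R + gamma + n'.+2%:R - 2%:R)) =
    (n'%:R + gamma) / (m%:R + n'%:R + gamma) * 
    \prod_(1 <= i < m.+1)
      ((alpha * (i%:R + gamma - 1) + beta) / (i%:R + gamma + n'.+1%:R - 2%:R)).
  elim: m => [|m IH].
    by rewrite !big_geq // mulr1 add0r divff.
  rewrite big_nat_recr //= [in RHS]big_nat_recr //= IH; field.
  by rewrite (nz _ (m + n')) 1?(nz _ (m + n').+1) //; ring.
(* Size 1 is separate: its triangle is empty, and the column and denominator identities start at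
   size 2. *)
elim: n => [|[|n] IH]; first by rewrite /hankel_product !big_geq ?mulr1.
  rewrite /hankel_product ![\prod_(1 <= i < 1) _]big_geq // big_nat1 mulr1 mul1r.
  by rewrite expr1; field; rewrite (nz _ 0%N) //; ring.
(* One copy of (alpha gamma + beta) / gamma goes to the new column, the others to the induction
   hypothesis. *)
rewrite hankel_product_recr [in RHS]hankel_product_recr exprSr mulrACA IH hankel_factor_row_shift //.
rewrite [X in _ = _ * X]big_nat_recr //= denom_shift.
field.
by rewrite (nz _ (n.+1 + n.+1)%N) 1?(nz _ (n.+1 + n)%N) 1?(nz _ n.+1) //; ring.
Qed.

Lemma hankel_transform0 (F : fieldType) (alpha beta gamma : F) (a : nat -> F)
    (n : nat) :
  (forall m, m%:R + gamma != 0) -> first_order_rec alpha beta gamma a ->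
  hankel_transform a n 0 = a 0 ^+ n * hankel_product alpha beta gamma n.
Proof.
elim: n => [|n IH] in beta gamma a *  => gamma_neq0 a_rec.
  by rewrite /hankel_transform det_mx00 /hankel_product big_geq // mulr1.
rewrite (hankel_transform_rec _ gamma_neq0 a_rec) (hankel_product_descent _ _ _ gamma_neq0).
have shifted_neq0 m : m%:R + (gamma + 2%:R) != 0.
  by rewrite addrCA -natrD addrC.
rewrite (IH _ _ _ shifted_neq0 (first_order_rec_descent gamma_neq0 a_rec)).
(* The first term of the descended sequence is [a 0] times exactly the base of the power in
   [hankel_product_descent]. *)
have -> : a 1 / (1 + gamma) =
    (alpha * gamma + beta) / (gamma * (1 + gamma)) * a 0.
  by rewrite a_rec; field; rewrite (gamma_neq0 1%N) -[gamma]add0r (gamma_neq0 0).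
by rewrite exprMn exprS; ring.
Qed.

(** Iterates the shift by one. The power of [a k] absorbs the prefactor of each step, because
    [a k.+1] is [a k] times (alpha (gamma + k) + beta) / (gamma + k); so no division by [a k]
    occurs. *)
Lemma hankel_product_shiftn (F : fieldType) (alpha beta gamma : F) (a : nat -> F)
    (n k : nat) :
  (forall m, m%:R + gamma != 0) -> first_order_rec alpha beta gamma a ->
  a k ^+ n * hankel_product alpha beta (gamma + k%:R) n =
  a 0 ^+ n * hankel_product alpha beta gamma n
  * \prod_(0 <= j < k) \prod_(1 <= i < n.+1)
      ((alpha * (i%:R + j%:R + gamma - 1) + beta)
       / (i%:R + j%:R + gamma + n%:R - 2%:R)).
Proof.
move=> gamma_neq0 a_rec; elim: k => [|k IH].
  by rewrite big_geq // addr0 mulr1.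
have shifted_neq0 m : m%:R + (gamma + k%:R) != 0.
  by rewrite addrCA -natrD addrC.
rewrite big_nat_recr //= mulrA -IH -mulrA.
under eq_bigr => i _ do rewrite -[i%:R + k%:R + gamma]addrA [k%:R + gamma]addrC.
rewrite -hankel_product_shift // mulrA -exprMn a_rec -addrA -natr1.
congr (_ ^+ _ * _); field.
by rewrite addrC gamma_neq0.
Qed.

Lemma hankel_transform_formula (F : fieldType) (alpha beta gamma : F)
    (a : nat -> F) (n k : nat) :
  (forall m, m%:R + gamma != 0) -> first_order_rec alpha beta gamma a ->
  hankel_transform a n k =
  a 0 ^+ n * hankel_product alpha beta gamma n
  * \prod_(0 <= j < k) \prod_(1 <= i < n.+1)
      ((alpha * (i%:R + j%:R + gamma - 1) + beta)
       / (i%:R + j%:R + gamma + n%:R - 2%:R)).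
Proof.
move=> gamma_neq0 a_rec.
have shifted_neq0 m : m%:R + (gamma + k%:R) != 0.
  by rewrite addrCA -natrD addrC.
have shifted_rec : first_order_rec alpha beta (gamma + k%:R) (fun m => a (m + k)%N).
  by move=> m; rewrite addSn a_rec natrD addrAC -addrA.
by rewrite hankel_transform_shift (hankel_transform0 _ shifted_neq0 shifted_rec)
           hankel_product_shiftn.
Qed.

Theorem theorem2p3 (R : realType) (alpha beta gamma : R[i]) (a : nat -> R[i])
    (hgamma : forall m : nat, gamma <> - m%:R)
    (ha : forall n : nat, a n.+1 = (alpha + beta / (n%:R + gamma)) * a n) :
  (a 0%N = 1 ->
     forall n k : nat, (1 <= n)%N ->
     hankel_transform a n k =
       (\prod_(1 <= i < n) \prod_(i <= j < n)
          (i%:R * (alpha * (i%:R + gamma - 1) + beta)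
                * (alpha * (i%:R - 1) - beta)
           / ((i%:R + gamma - 1) * (i%:R + j%:R + gamma - 2%:R)
                * (i%:R + j%:R + gamma - 1))))
       * (\prod_(0 <= j < k) \prod_(1 <= i < n.+1)
          ((alpha * (i%:R + j%:R + gamma - 1) + beta)
           / (i%:R + j%:R + gamma + n%:R - 2%:R))))
  /\
  (forall n k : nat, (1 <= n)%N ->
     hankel_transform a n k =
       a 0%N ^+ n
       * (\prod_(1 <= i < n) \prod_(i <= j < n)
          (i%:R * (alpha * (i%:R + gamma - 1) + beta)
                * (alpha * (i%:R - 1) - beta)
           / ((i%:R + gamma - 1) * (i%:R + j%:R + gamma - 2%:R)
                * (i%:R + j%:R + gamma - 1))))
       * (\prod_(0 <= j < k) \prod_(1 <= i < n.+1)
          ((alpha * (i%:R + j%:R + gamma - 1) + beta)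
           / (i%:R + j%:R + gamma + n%:R - 2%:R)))).
Proof.
have gamma_neq0 m : m%:R + gamma != 0.
  by apply/eqP => /eqP; rewrite addrC addr_eq0 => /eqP; apply: hgamma.
by split=> [a0 n k _|n k _];
  rewrite (hankel_transform_formula _ _ gamma_neq0 ha) // a0 expr1n mul1r.
Qed.
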